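(* Let $U$ be a finite set and let $P=\{\mathbf{p}_1,\dots,\mathbf{p}_h\}$ and $Q=\{\mathbf{q}_1,\dots,\mathbf{q}_h\}$ be two families of nonempty subsets of $U$ (''super vertices'') such that any two distinct members of $P$ are disjoint, any two distinct members of $Q$ are disjoint, no set belongs to both $P$ and $Q$, and $\mathbf{p}_1\cup\cdots\cup\mathbf{p}_h=\mathbf{q}_1\cup\cdots\cup\mathbf{q}_h$. Then the Common Super Vertex Counting procedure (described in the context), run on input $(P,Q)$, returns the maximum number of common super vertices between $P$ and $Q$ after all possible contractions.
   Context: A contraction of a family of pairwise disjoint sets replaces two of its members $\mathbf{a},\mathbf{b}$ by their union $\mathbf{a}\cup\mathbf{b}$. ''The maximum number of common super vertices between $P$ and $Q$ after all possible contractions'' is the maximum of $|P'\cap Q'|$ over all families $P'$ obtained from $P$ by a finite sequence of contractions and all families $Q'$ obtained from $Q$ by a finite sequence of contractions (a common super vertex being a set that is a member of both families). The Common Super Vertex Counting procedure is: set $c:=0$. While $P\neq\emptyset$: pick an arbitrary $\mathbf{p}_i\in P$; find $\mathbf{q}_j\in Q$ with $\mathbf{p}_i\cap\mathbf{q}_j\neq\emptyset$. If $\mathbf{q}_j\setminus\mathbf{p}_i\neq\emptyset$, find $\mathbf{p}_{i'}\in P\setminus\{\mathbf{p}_i\}$ with $\mathbf{p}_{i'}\cap(\mathbf{q}_j\setminus\mathbf{p}_i)\neq\emptyset$, set $\mathbf{p}_{ii'}:=\mathbf{p}_i\cup\mathbf{p}_{i'}$ and $P:=P\cup\{\mathbf{p}_{ii'}\}\setminus\{\mathbf{p}_i,\mathbf{p}_{i'}\}$;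 otherwise $\mathbf{p}_{ii'}:=\mathbf{p}_i$. If $\mathbf{p}_i\setminus\mathbf{q}_j\neq\emptyset$, find $\mathbf{q}_{j'}\in Q\setminus\{\mathbf{q}_j\}$ with $\mathbf{q}_{j'}\cap(\mathbf{p}_i\setminus\mathbf{q}_j)\neq\emptyset$, set $\mathbf{q}_{jj'}:=\mathbf{q}_j\cup\mathbf{q}_{j'}$ and $Q:=Q\cup\{\mathbf{q}_{jj'}\}\setminus\{\mathbf{q}_j,\mathbf{q}_{j'}\}$; otherwise $\mathbf{q}_{jj'}:=\mathbf{q}_j$. If $\mathbf{p}_{ii'}=\mathbf{q}_{jj'}$, remove $\mathbf{p}_{ii'}$ from $P$ and $\mathbf{q}_{jj'}$ from $Q$ and set $c:=c+1$. When the loop ends, return $c$. *)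

(* Defs.v *)
From mathcomp Require Import all_boot.
Set Implicit Arguments.
Unset Strict Implicit.
Unset Printing Implicit Defensive.

Section Contraction.
Variable T : finType.
Implicit Types (F P Q : {set {set T}}) (a b p q : {set T}).

Definition contraction : rel {set {set T}} := fun F F' =>
  [exists a in F, exists b in F,
    (a != b) && (F' == (a :|: b) |: (F :\: [set a; b]))].

(* There are finitely many families of subsets of T, so the maximum over all
   contractions is a finite one. It ranges over a nonempty set, since
   [connect] is reflexive. *)
Definition max_common P Q : nat :=
  \max_(P' | connect contraction P P')
    \max_(Q' | connect contraction Q Q') #|P' :&: Q'|.

(* [absorb F a b o]: o is a possible outcome of the instruction "if b \ a is
   nonempty, find a' in F \ {a} meeting b \ a and replace a, a' by a :|: a'
   in F". An outcome is the updated family with the set now standing for a,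
   or None if the search for a' fails. *)
Inductive absorb F a b : option ({set {set T}} * {set T}) -> Prop :=
| AbsorbSkip :
    b :\: a = set0 -> absorb F a b (Some (F, a))
| AbsorbMerge a' :
    b :\: a != set0 -> a' \in F :\ a -> a' :&: (b :\: a) != set0 ->
    absorb F a b (Some ((F :|: [set a :|: a']) :\: [set a; a'], a :|: a'))
| AbsorbFail :
    b :\: a != set0 ->
    (forall a', a' \in F :\ a -> a' :&: (b :\: a) = set0) ->
    absorb F a b None.

(* The two families and the counter c. *)
Definition state : Type := {set {set T}} * {set {set T}} * nat.

(* [body s o]: o is a possible outcome of one execution of the loop body from
   s, where None means that one of its searches has failed. Every admissible
   choice of p, q and of the absorbed sets gives an outcome. *)
Inductive body : state -> option state -> Prop :=
| BodyFailFind P Q c p :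
    p \in P -> (forall q, q \in Q -> p :&: q = set0) ->
    body (P, Q, c) None
| BodyFailP P Q c p q :
    p \in P -> q \in Q -> p :&: q != set0 -> absorb P p q None ->
    body (P, Q, c) None
| BodyFailQ P Q c p q P' p' :
    p \in P -> q \in Q -> p :&: q != set0 ->
    absorb P p q (Some (P', p')) -> absorb Q q p None ->
    body (P, Q, c) None
| BodyOk P Q c p q P' p' Q' q' :
    p \in P -> q \in Q -> p :&: q != set0 ->
    absorb P p q (Some (P', p')) -> absorb Q q p (Some (Q', q')) ->
    body (P, Q, c)
      (Some (if p' == q' then (P' :\ p', Q' :\ q', c.+1) else (P', Q', c))).

(* [loop_returns m s]: whatever choices are made, the loop started from s
   terminates, no search fails, and the value returned is m. Being inductive,
   the predicate excludes infinite runs. *)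
Inductive loop_returns (m : nat) : state -> Prop :=
| LoopHalt Q : loop_returns m (set0, Q, m)
| LoopIter P Q c :
    P != set0 -> ~ body (P, Q, c) None ->
    (forall s, body (P, Q, c) (Some s) -> loop_returns m s) ->
    loop_returns m (P, Q, c).

Definition csvc_returns P Q (m : nat) : Prop := loop_returns m (P, Q, 0).

End Contraction.

(* Main.v *)
Require Import Defs.
From mathcomp Require Import all_boot.

(** Let [C] be the finest partition of the common ground set that is coarser
    than both [P] and [Q], i.e. the connected components of the intersection
    graph of [P] and [Q]. A common super vertex is a union of components, and
    contracting every component to a single set is possible on both sides, so
    the maximum is [#|C|]. The procedure preserves [c + #|C|]: it merges only
    sets meeting a common set of the other family, hence lying in the same
    component, and a set that it removes from both families is a component. *)

Set Implicit Arguments.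
Unset Strict Implicit.
Unset Printing Implicit Defensive.

Section Components.
Variable T : finType.
Implicit Types (F P Q C : {set {set T}}) (a b p q c B D : {set T}).

(** * Saturated sets and pointwise forms of the partition axioms *)

(** For a partition [F] of [D] and [B \subset D], this says that [B] is a union of members of
    [F]. *)
Definition saturated F B :=
  [forall p in F, (p \subset B) || [disjoint p & B]].

(** Connectedness is stated without paths: no component has a nonempty proper subset that is
    saturated for both families. *)
Definition components P Q C :=
  [/\ partition C (cover P),
      forall c, c \in C -> saturated P c && saturated Q c &
      forall B c, c \in C -> B \subset c -> B != set0 ->
        saturated P B -> saturated Q B -> B = c].

Lemma saturatedP F B :
  reflect (forall p x, p \in F -> x \in p -> x \in B -> p \subset B)
          (saturated F B).
Proof.
apply: (iffP forall_inP) => [sFB p x pF xp xB | sFB p pF].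
  case/orP: (sFB p pF) => // /pred0P /(_ x) /=.
  by rewrite xp xB.
case: (boolP [disjoint p & B]) => [_|]; first by rewrite orbT.
case/pred0Pn => x /andP[xp xB].
by rewrite (sFB p x).
Qed.

Lemma partition_eq F D p q x :
  partition F D -> p \in F -> q \in F -> x \in p -> x \in q -> p = q.
Proof.
case/and3P => _ tF _ pF qF xp xq.
by rewrite -(def_pblock tF pF xp) (def_pblock tF qF xq).
Qed.

Lemma partition_ex F D x :
  partition F D -> x \in D -> exists2 p, p \in F & x \in p.
Proof. by case/and3P => /eqP <- _ _ /bigcupP[p pF xp]; exists p. Qed.

Lemma partition_neq0 F D p : partition F D -> p \in F -> exists x, x \in p.
Proof.
case/and3P => _ _ F0 pF; apply/set0Pn.
by apply: contraNneq F0 => <-.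
Qed.

Lemma partition_sub F D p : partition F D -> p \in F -> p \subset D.
Proof. by case/and3P => /eqP <- _ _ pF; apply: bigcup_sup pF. Qed.

Lemma partition_intro F D :
  (forall p x, p \in F -> x \in p -> x \in D) ->
  (forall x, x \in D -> exists2 p, p \in F & x \in p) ->
  (forall p, p \in F -> exists x, x \in p) ->
  (forall p q x, p \in F -> q \in F -> x \in p -> x \in q -> p = q) ->
  partition F D.
Proof.
move=> subD exF F0 eqF; apply/and3P; split.
- apply/eqP/setP => x; apply/bigcupP/idP => [[p pF xp]|/exF[p pF xp]].
    exact: subD pF xp.
  by exists p.
- apply/trivIsetP => p q pF qF; apply: contraR.
  by case/pred0Pn => x /andP[xp xq]; apply/eqP; apply: eqF xp xq.
- by apply/negP => /F0[x]; rewrite inE.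
Qed.

(** * A single contraction *)

Definition merge F a b := (a :|: b) |: (F :\: [set a; b]).

Lemma mergeP F a b p :
  reflect (p = a :|: b \/ [/\ p \in F, p != a & p != b]) (p \in merge F a b).
Proof.
rewrite !inE negb_or -andbA.
apply: (iffP orP) => [[/eqP|/and3P[? ? ?]]|[->|[-> -> ->]]]; try by left.
- by right.
- by right.
Qed.

Section Merge.
Variables (F : {set {set T}}) (D a b : {set T}).
Hypotheses (pF : partition F D) (aF : a \in F) (bF : b \in F) (ab : a != b).

(** As a member, the union would share points with both [a] and [b], hence equal both. *)
Lemma merge_new : a :|: b \notin F.
Proof.
have [x xa] := partition_neq0 pF aF; have [y yb] := partition_neq0 pF bF.
apply: contra ab => abF; apply/eqP.
rewrite (partition_eq (x := x) pF aF abF) ?inE ?xa //.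
by rewrite [RHS](partition_eq (x := y) pF bF abF) ?inE ?yb ?orbT.
Qed.

Lemma merge_partition : partition (merge F a b) D.
Proof.
have [sa sb] := (partition_sub pF aF, partition_sub pF bF).
apply: partition_intro.
- move=> p x /mergeP[->|[pinF _ _]]; first by apply/subsetP; rewrite subUset sa.
  exact/subsetP/(partition_sub pF pinF).
- move=> x /(partition_ex pF)[p pinF xp].
  have [Ep|pa] := eqVneq p a.
    by exists (a :|: b); [apply/mergeP; left | rewrite inE -Ep xp].
  have [Ep|pb] := eqVneq p b.
    by exists (a :|: b); [apply/mergeP; left | rewrite inE -Ep xp orbT].
  by exists p => //; apply/mergeP; right.
- move=> p /mergeP[->|[pinF _ _]]; last exact: partition_neq0 pF pinF.
  by have [x xa] := partition_neq0 pF aF; exists x; rewrite inE xa.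
- have key p x : p \in F -> p != a -> p != b -> x \in p -> x \notin a :|: b.
    move=> pinF pa pb xp; rewrite inE negb_or; apply/andP; split.
      by apply: contra pa => xa; rewrite (partition_eq pF pinF aF xp xa).
    by apply: contra pb => xb; rewrite (partition_eq pF pinF bF xp xb).
  move=> p q x /mergeP[->|[pinF pa pb]] /mergeP[->|[qF qa qb]] xp xq //.
  + by rewrite (negPf (key _ _ qF qa qb xq)) in xp.
  + by rewrite (negPf (key _ _ pinF pa pb xp)) in xq.
  + exact: partition_eq pF pinF qF xp xq.
Qed.

(** Two members leave and one new set enters. This drop drives the later inductions on size. *)
Lemma card_merge : #|merge F a b| < #|F|.
Proof.
rewrite /merge cardsU1 inE (negPf merge_new) andbF /= add1n.
rewrite cardsD.
have -> : F :&: [set a; b] = [set a; b].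
  by apply/setIidPr/subsetP => x /set2P[] ->.
have : #|[set a; b]| <= #|F| by apply/subset_leq_card/subsetP => x /set2P[] ->.
by rewrite cards2 ab /= => F1; rewrite -subSn // subSS ltn_subrL (ltnW F1).
Qed.

Lemma saturated_merge B : saturated (merge F a b) B -> saturated F B.
Proof.
move/saturatedP => sB; apply/saturatedP => p x pinF xp xB.
have abM : a :|: b \in merge F a b by apply/mergeP; left.
have [Ep|pa] := eqVneq p a.
  apply: subset_trans (sB _ x abM _ xB); first by rewrite Ep subsetUl.
  by rewrite inE -Ep xp.
have [Ep|pb] := eqVneq p b.
  apply: subset_trans (sB _ x abM _ xB); first by rewrite Ep subsetUr.
  by rewrite inE -Ep xp orbT.
by apply: sB xp xB; apply/mergeP; right.
Qed.

Lemma merge_saturated B :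
  saturated F B -> (a \subset B) = (b \subset B) -> saturated (merge F a b) B.
Proof.
move/saturatedP => sB eqab; apply/saturatedP => p x /mergeP[->|[pinF _ _]].
  case/setUP => [xa|xb] xB; rewrite subUset.
    by have sa := sB _ _ aF xa xB; rewrite -eqab sa.
  by have sb := sB _ _ bF xb xB; rewrite eqab sb.
exact: sB.
Qed.

End Merge.

(** * Sequences of contractions *)

Lemma connect_partition P P' D :
  partition P D -> connect (@contraction T) P P' ->
  partition P' D /\ (forall B, B \in P' -> saturated P B).
Proof.
move=> pP /connectP[s]; elim: s P pP => [|F s IH] P pP /=.
  move=> _ ->; split=> // B BP; apply/saturatedP => p x pinP xp xB.
  by rewrite (partition_eq pP pinP BP xp xB).
case/andP => /exists_inP[a aP /exists_inP[b bP /andP[ab /eqP ->]]] sP lP.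
have [pP' satP'] := IH _ (merge_partition pP aP bP) sP lP.
split=> // B BP'; exact/(saturated_merge (a := a) (b := b))/satP'.
Qed.

(** Merge two members lying in a common block of [C] as long as there are any; once there are none,
    the family is [C] itself. *)
Lemma connect_saturated P C D :
  partition P D -> partition C D -> (forall c, c \in C -> saturated P c) ->
  connect (@contraction T) P C.
Proof.
move=> + pC; have [n] := ubnP #|P|; elim: n P => // n IH P leP pP satC.
case: (boolP [exists a in P, exists b in P, (a != b) &&
          [exists c in C, (a \subset c) && (b \subset c)]]) => [|noab].
  case/exists_inP => a aP /exists_inP[b bP /andP[ab]].
  case/exists_inP => c cC /andP[ac bc].
  apply: (@connect_trans _ _ (merge P a b)).
    apply/connect1/exists_inP; exists a => //.
    by apply/exists_inP; exists b; rewrite ?ab /=.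
  apply: IH; last 1 first.
  (* Both [a] and [b] lie in [c], so a block [d] containing either one is [c] and contains the
     other. *)
  - move=> d dC; apply: merge_saturated => //; first exact: satC.
    have [x xa] := partition_neq0 pP aP; have [y yb] := partition_neq0 pP bP.
    apply/idP/idP => /subsetP sd.
      by rewrite (partition_eq pC dC cC (sd _ xa) (subsetP ac _ xa)).
    by rewrite (partition_eq pC dC cC (sd _ yb) (subsetP bc _ yb)).
  - exact: leq_trans (card_merge pP aP bP ab) leP.
  - exact: merge_partition.
(* A block meeting two members of [P] contains both by saturation, so they could still be merged. *)
have CP c : c \in C -> c \in P.
  move=> cC; have [x xc] := partition_neq0 pC cC.
  have cD := subsetP (partition_sub pC cC).
  have [a aP xa] := partition_ex pP (cD _ xc).
  have sat := elimT (saturatedP _ _) (satC c cC).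
  have ac := sat _ _ aP xa xc.
  suff -> : c = a by [].
  apply/eqP; rewrite eqEsubset ac andbT; apply/subsetP => y yc.
  have [b bP yb] := partition_ex pP (cD _ yc).
  have [->//|ab] := eqVneq a b.
  case/negP: noab; apply/exists_inP; exists a => //.
  apply/exists_inP; exists b; rewrite ?ab //=.
  by apply/exists_inP; exists c; rewrite ?ac ?(sat _ _ bP yb yc).
suff -> : P = C by exact: connect0.
apply/setP => p; apply/idP/idP => [pinP|/CP //].
have [x xp] := partition_neq0 pP pinP.
have [c cC xc] := partition_ex pC (subsetP (partition_sub pP pinP) _ xp).
by rewrite (partition_eq pP pinP (CP _ cC) xp xc).
Qed.

(** * Components and the maximum *)

(** The components are the classes of points that no set saturated for both families separates;
    minimality is then immediate. *)
Lemma components_exist P Q : cover P = cover Q ->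
  exists C, components P Q C.
Proof.
move=> eqPQ.
pose e : rel T := fun x y =>
  [forall B, (saturated P B && saturated Q B) ==> ((x \in B) == (y \in B))].
have eP x y : reflect (forall B, saturated P B -> saturated Q B ->
    (x \in B) = (y \in B)) (e x y).
  apply: (iffP forallP) => [h B sP sQ | h B].
    by have := h B; rewrite sP sQ /= => /eqP.
  by apply/implyP => /andP[sP sQ]; apply/eqP/h.
have eqe : {in cover P & &, equivalence_rel e}.
  move=> x y z _ _ _; split; first exact/eP.
  move/eP => exy; apply/eP/eP => h B sP sQ; first by rewrite -exy ?h.
  by rewrite exy ?h.
have part := equivalence_partitionP eqe.
have sat F x : cover F = cover P ->
    (forall B, saturated P B -> saturated Q B -> saturated F B) ->
    saturated F [set y in cover P | e x y].
  move=> eqF sF; apply/saturatedP => p y pinF yp; rewrite inE => /andP[_ /eP exy].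
  apply/subsetP => z zp; rewrite inE -eqF; apply/andP; split.
    by apply/bigcupP; exists p.
  apply/eP => B sP sQ; rewrite exy //.
  have /saturatedP sB := sF B sP sQ.
  apply/idP/idP => [yB|zB]; first exact: subsetP (sB _ _ pinF yp yB) _ zp.
  exact: subsetP (sB _ _ pinF zp zB) _ yp.
exists (equivalence_partition e (cover P)); split=> //.
- by move=> c /imsetP[x _ ->]; rewrite !sat.
- move=> B c /imsetP[x xD ->] Bc /set0Pn[y yB] sP sQ.
  apply/eqP; rewrite eqEsubset Bc; apply/subsetP => z.
  rewrite inE => /andP[_ /eP <- //].
  by have := subsetP Bc _ yB; rewrite inE => /andP[_ /eP ->].
Qed.

(** For the upper bound, each common super vertex is sent to a component inside it, injectively by
    disjointness. For the lower bound, both families contract to [C]. *)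
Lemma max_common_components P Q C D :
  partition P D -> partition Q D -> components P Q C -> max_common P Q = #|C|.
Proof.
move=> pP pQ [pC satC minC].
have coP : cover P = D by case/and3P: pP => /eqP.
rewrite coP in pC; apply/eqP; rewrite eqn_leq; apply/andP; split.
  apply/bigmax_leqP => P' /(connect_partition pP)[pP' satP'].
  apply/bigmax_leqP => Q' /(connect_partition pQ)[_ satQ'].
  (* The default [set0] is never taken on common members, by [fP]. *)
  pose f B := odflt set0 [pick c in C | c \subset B].
  have fP B : B \in P' :&: Q' -> f B \in C /\ f B \subset B.
    rewrite inE /f => /andP[BP BQ]; case: pickP => [c /andP[] //|/= noc].
    have [x xB] := partition_neq0 pP' BP.
    have [c cC xc] := partition_ex pC (subsetP (partition_sub pP' BP) _ xB).
    have := noc c; rewrite cC /= => /negP[]; apply/setIidPr.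
    (* If [c] meets [B], then [B :&: c] is nonempty and saturated for both families, so minimality
       makes it all of [c]. *)
    have satI F : saturated F B -> saturated F c -> saturated F (B :&: c).
      move=> /saturatedP sB /saturatedP sc; apply/saturatedP => p y pinF yp.
      by rewrite inE subsetI => /andP[yB yc]; rewrite (sB p y) ?(sc p y).
    case/andP: (satC c cC) => scP scQ.
    apply: minC cC _ _ (satI _ (satP' _ BP) scP) (satI _ (satQ' _ BQ) scQ).
      exact: subsetIr.
    by apply/set0Pn; exists x; rewrite inE xB.
  have injf : {in P' :&: Q' &, injective f}.
    move=> A B AI BI eqf; have [fA sA] := fP A AI; have [_ sB] := fP B BI.
    have [x xf] := partition_neq0 pC fA.
    move: AI BI; rewrite !inE => /andP[AP _] /andP[BP _].
    apply: partition_eq pP' AP BP (subsetP sA _ xf) (subsetP sB _ _).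
    by rewrite -eqf.
  rewrite -(card_in_imset injf); apply/subset_leq_card/subsetP.
  by move=> _ /imsetP[B BI ->]; case: (fP B BI).
have cP : connect (@contraction T) P C.
  by apply: connect_saturated pP pC _ => c /satC/andP[].
have cQ : connect (@contraction T) Q C.
  by apply: connect_saturated pQ pC _ => c /satC/andP[].
apply: (bigmax_sup C) => //; apply: (bigmax_sup C) => //.
by rewrite setIid.
Qed.

(** * The procedure and its invariant *)

(** The size clauses serve termination. The last two say that [F] and [F'] have the same saturated
    sets among those that do not split [b]. *)
Variant absorbed F D a b F' a' : Prop :=
  Absorbed of partition F' D & a' \in F' & #|F'| <= #|F|
    & (b :\: a != set0 -> #|F'| < #|F|) & (b \subset a -> a' = a)
    & (forall B, saturated F' B -> saturated F B)
    & (forall B, saturated F B -> saturated [set b] B -> saturated F' B).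

(** The set [b] meets both [a] and the absorbed [a'], so a saturated set that does not split [b]
    contains both or neither. *)
Lemma absorbP F D a b o :
  partition F D -> a \in F -> b \subset D -> a :&: b != set0 ->
  absorb F a b o ->
  if o is Some (F', a') then absorbed F D a b F' a' else False.
Proof.
move=> pF aF bD /set0Pn[z]; rewrite inE => /andP[za zb].
case=> [b0 | a' ba /setD1P[a'a a'F] /set0Pn[y] | /set0Pn[y yba] none].
- by split=> //; rewrite b0 eqxx.
- rewrite !inE => /and3P[ya' ya yb].
  (* The procedure adds the union before deleting; the order is immaterial because the union is
     neither [a] nor [a']. *)
  have -> : (F :|: [set a :|: a']) :\: [set a; a'] = merge F a a'.
    have new := merge_new pF aF a'F; rewrite eq_sym a'a in new.
    apply/setP => p; rewrite !inE.
    have [->|_] := eqVneq p (a :|: a'); last by rewrite orbF.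
    rewrite orbT andbT negb_or /=.
    by apply/andP; split; apply: contraNneq (new isT) => ->.
  rewrite eq_sym in a'a.
  have lt := card_merge pF aF a'F a'a.
  split=> //.
  + exact: merge_partition.
  + by apply/mergeP; left.
  + exact: ltnW.
  + by rewrite -setD_eq0 (negPf ba).
  + by move=> B; apply: saturated_merge.
  + move=> B sF /saturatedP sb; apply: merge_saturated => //.
    have /saturatedP sB := sF.
    have bB x : x \in b -> x \in B -> b \subset B.
      by apply: sb; rewrite inE.
    apply/idP/idP => /subsetP s.
      by apply: (sB _ y) => //; apply: (subsetP (bB z zb (s z za))).
    by apply: (sB _ z) => //; apply: (subsetP (bB y yb (s y ya'))).
(* The search cannot fail: a point of [b :\: a] is covered by some member of [F], which differs from
   [a]. *)
- move: (yba); rewrite inE => /andP[ya yb].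
  have [a' a'F ya'] := partition_ex pF (subsetP bD _ yb).
  have /none/setP/(_ y) : a' \in F :\ a.
    by rewrite !inE a'F andbT; apply: contraNneq ya => <-.
  by rewrite inE ya' yba inE.
Qed.

Lemma saturated_in F b B : b \in F -> saturated F B -> saturated [set b] B.
Proof.
move=> bF /saturatedP sB; apply/saturatedP => p x /set1P -> xb xB.
exact: sB bF xb xB.
Qed.

Lemma partitionD1 F D p :
  partition F D -> p \in F -> partition (F :\ p) (D :\: p).
Proof.
move=> pF pinF; apply: partition_intro.
- move=> q x /setD1P[qp qF] xq; rewrite inE (subsetP (partition_sub pF qF)) // andbT.
  by apply: contra qp => xp; rewrite (partition_eq pF qF pinF xq xp).
- move=> x /setDP[/(partition_ex pF)[q qF xq] xp]; exists q => //.
  by rewrite !inE qF andbT; apply: contraNneq xp => <-.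
- by move=> q /setD1P[_ qF]; apply: partition_neq0 pF qF.
- by move=> q r x /setD1P[_ qF] /setD1P[_ rF]; apply: partition_eq pF qF rF.
Qed.

(** A common member is saturated for both partitions and lies in the component it meets, hence is
    that component. *)
Lemma componentsD1 P Q C D p :
  partition P D -> partition Q D -> components P Q C ->
  p \in P -> p \in Q -> p \in C /\ components (P :\ p) (Q :\ p) (C :\ p).
Proof.
move=> pP pQ [pC satC minC] pinP pinQ.
have coP : cover P = D by case/and3P: pP => /eqP.
have coP' : cover (P :\ p) = D :\: p.
  by case/and3P: (partitionD1 pP pinP) => /eqP.
rewrite coP in pC.
have pinC : p \in C.
  have [x xp] := partition_neq0 pP pinP.
  have [c cC xc] := partition_ex pC (subsetP (partition_sub pP pinP) _ xp).
  have sp F : partition F D -> p \in F -> saturated F p.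
    move=> pF pinF; apply/saturatedP => q y qF yq yp.
    by rewrite (partition_eq pF qF pinF yq yp).
  case/andP: (satC c cC) => /saturatedP scP _.
  rewrite (minC p c) ?sp //; first exact: scP xp xc.
  by apply/set0Pn; exists x.
split=> //; split.
- by rewrite coP'; apply: partitionD1.
- move=> c /setD1P[_ cC]; case/andP: (satC c cC).
  move=> /saturatedP scP /saturatedP scQ; apply/andP.
  by split; apply/saturatedP => q x /setD1P[_]; [apply: scP | apply: scQ].
- move=> B c /setD1P[cp cC] Bc B0 sP sQ.
  (* [B] lies in a component other than [p], so it misses [p], and restoring [p] preserves
     saturation. *)
  have sat F : saturated (F :\ p) B -> saturated F B.
    move=> /saturatedP sB; apply/saturatedP => q x qF xq xB.
    have [qp|qp] := eqVneq q p; last by apply: sB xq xB; rewrite !inE qp.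
    have xp : x \in p by rewrite -qp.
    by rewrite (partition_eq pC cC pinC (subsetP Bc _ xB) xp) eqxx in cp.
  by apply: minC => //; apply: sat.
Qed.

(** Induction on [#|P| + #|Q|], which drops in every iteration while counter plus number of
    components stays fixed. *)
Lemma loop_returns_components P Q C D k :
  partition P D -> partition Q D -> components P Q C ->
  loop_returns (k + #|C|) (P, Q, k).
Proof.
have [n] := ubnP (#|P| + #|Q|).
elim: n P Q C D k => // n IH P Q C D k leN pP pQ compC.
have coP : cover P = D by case/and3P: pP => /eqP.
have [P0|Pn0] := eqVneq P set0.
  case: compC => pC _ _; rewrite P0.
  have -> : C = set0.
    apply/eqP; rewrite -subset0; apply/subsetP => c cC.
    have [x xc] := partition_neq0 pC cC.
    have := subsetP (partition_sub pC cC) _ xc.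
    by rewrite P0 /cover big_set0 inE.
  by rewrite cards0 addn0; constructor.
constructor=> //.
  move Es: (P, Q, k) => s; move Eo: None => o H.
  case: H Es Eo => [P1 Q1 c p + + [EP EQ _] | P1 Q1 c p q + + + + [EP EQ _]
    | P1 Q1 c p q P' p' + + + + + [EP EQ _] | //]; rewrite -EP -EQ.
  - move=> pinP noq _; have [x xp] := partition_neq0 pP pinP.
    have [q qQ xq] := partition_ex pQ (subsetP (partition_sub pP pinP) _ xp).
    by have /setP/(_ x) := noq q qQ; rewrite !inE xp xq.
  - by move=> pinP qQ pq /(absorbP pP pinP (partition_sub pQ qQ) pq).
  - move=> pinP qQ pq _; rewrite setIC in pq.
    by move/(absorbP pQ qQ (partition_sub pP pinP) pq).
move=> s; move Es: (P, Q, k) => s0; move Eo: (Some s) => o H.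
case: H Es Eo => // P1 Q1 c p q P' p' Q' q' + + + + + [EP EQ <-] [->].
rewrite -EP -EQ => pinP qQ pq.
case/(absorbP pP pinP (partition_sub pQ qQ) pq) => pP' p'P' leP ltP eqp satP satP'.
rewrite setIC in pq.
case/(absorbP pQ qQ (partition_sub pP pinP) pq) => pQ' q'Q' leQ ltQ eqq satQ satQ'.
have coP' : cover P' = D by case/and3P: pP' => /eqP.
(* Both absorptions use the original [p] and [q], which no set saturated for [P] and [Q] splits. So
   the sets saturated for both families stay the same. *)
have compC' : components P' Q' C.
  case: compC => pC satC minC; split; first by rewrite coP' -coP.
    move=> c' /satC /andP[sP sQ].
    by rewrite satP' ?satQ' //; [apply: saturated_in sP | apply: saturated_in sQ].
  by move=> B c' cC Bc B0 /satP sP /satQ; apply: minC.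
case: ifP => [/eqP Epq | npq]; last first.
  (* Without any absorption [p] and [q] contain each other, so they would be equal and removed. *)
  have lt : #|P'| + #|Q'| < #|P| + #|Q|.
    case: (boolP (q \subset p)) => [qp | qp]; last first.
      by rewrite -setD_eq0 in qp; rewrite -addSn leq_add ?ltP.
    case: (boolP (p \subset q)) => [pq' | pq']; last first.
      by rewrite -setD_eq0 in pq'; rewrite -addnS leq_add ?ltQ.
    have Epq : p = q by apply/eqP; rewrite eqEsubset pq' qp.
    by rewrite eqp ?eqq // Epq eqxx in npq.
  exact: IH (leq_trans lt leN) pP' pQ' compC'.
rewrite -Epq in q'Q' *.
have [p'C compC1] := componentsD1 pP' pQ' compC' p'P' q'Q'.
(* The removed set is one component, which pays for the increment of the counter. *)
rewrite (cardsD1 p' C) p'C /= addnA addn1.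
apply: IH (partitionD1 pP' p'P') (partitionD1 pQ' q'Q') compC1.
(* The removal shrinks both families, so the measure drops even if nothing was absorbed. *)
rewrite ltnS in leN; apply: leq_trans leN; apply: leq_trans (leq_add leP leQ).
by rewrite (cardsD1 p' P') (cardsD1 p' Q') p'P' q'Q' addSn ltnS leq_add.
Qed.

End Components.

Theorem theorem1 (U : finType) (h : nat) (P Q : {set {set U}})
    (cardP : #|P| = h) (cardQ : #|Q| = h)
    (P_nonempty : set0 \notin P) (Q_nonempty : set0 \notin Q)
    (P_disj : trivIset P) (Q_disj : trivIset Q)
    (PQ_disj : [disjoint P & Q]) (coverPQ : cover P = cover Q) :
  csvc_returns P Q (max_common P Q).
Proof.
have pP : partition P (cover P) by apply/and3P.
have pQ : partition Q (cover P) by apply/and3P; rewrite coverPQ.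
have [C compC] := components_exist coverPQ.
rewrite (max_common_components pP pQ compC) -[#|C|]add0n.
exact: loop_returns_components pP pQ compC.
Qed.
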